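(* The rule diagram algebra $(\mathcal D,+,\cdot,*_{\mathcal D})$ is an associative unital $\mathbb K$-algebra, whose unit under composition is the empty rule diagram $d_\emptyset$.
   Context: $\mathbb K$ is a field (such as $\mathbb R$ or $\mathbb C$). Relations. For finite sets $A,B$ a relation is a subset $R\subseteq A\times B$; $S\circ R=\{(a,c)\mid \exists b:(a,b)\in R,(b,c)\in S\}$; for a relation $R$ on one set, $R^*$ is its reflexive transitive closure. $R$ is one-to-one if distinct pairs $(a_1,b_1)\ne(a_2,b_2)$ in $R$ have $a_1\neq a_2$ and $b_1\neq b_2$. Graphs and linear rules. A graph is a finite directed multigraph $G=(V_G,E_G,s_G,t_G)$ (loops allowed). A linear rule $r:I\rightharpoonup O$ is an injective partial graph morphism: a pair of one-to-one relations $r\subseteq (V_I\times V_O)\uplus(E_I\times E_O)$ such that for edges $(e,e')\in r$ implies $(s(e),s(e')),(t(e),t(e'))\in r$. It is connected if it is not empty and is not a disjoint union of two non-empty rules (either of $I,O$, as well as $r$, may be empty). Rule diagrams. A rule diagram $\mathfrak d=(I,O,r,m,s,t)$ consists of graphs $I=\biguplus_{i=1}^n I_i$, $O=\biguplus_{i=1}^n O_i$ (with $s,t$ the source and target maps of $I\uplus O$), $r=\biguplus_i r_i$ with each $r_i:I_i\rightharpoonup O_i$ a connected linear rule, and a one-to-one relation $m=\biguplus_{i<j}m_{i,j}$ (''matches''), where $m_{i,j}\subseteq (V_{O_j}\times V_{I_i})\uplus(E_{O_j}\times E_{I_i})$, such that with $\omega_m:=m\circ(r\circ m)^*$ the delayed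 edge morphism condition holds: for all edges $e,e'$, $(e,e')\in\omega_m$ implies $(s(e),s(e'))\in\omega_m$ and $(t(e),t(e'))\in\omega_m$. The numbering of the constituents is not part of the data. The empty rule diagram ($n=0$) is denoted $\mathfrak d_\emptyset$. An isomorphism of rule diagrams is a pair of graph isomorphisms $i_I:I\to I'$, $i_O:O\to O'$ with $r'=i_O\circ r\circ i_I^{-1}$, $m'=i_I\circ m\circ i_O^{-1}$. The rule diagram algebra. $\mathcal D$ is the $\mathbb K$-vector space with basis the set $\mathfrak D$ of isomorphism classes of rule diagrams; $d_\emptyset$ is the basis vector of $\mathfrak d_\emptyset$. For $\mathfrak d_A,\mathfrak d_B\in\mathfrak D$ (with chosen representatives) and a one-to-one relation $m_{AB}$ from $O_B$ to $I_A$ (vertices to vertices, edges to edges) put $$\mathfrak d_A\overset{m_{AB}}{\blacktriangleleft}\mathfrak d_B:=(I_A\uplus I_B,O_A\uplus O_B,r_A\uplus r_B,m_A\uplus m_{AB}\uplus m_B,s_A\uplus s_B,t_A\uplus t_B),$$ and let $\mathcal M_{\mathfrak d_A}(\mathfrak d_B)$ be the set of those $m_{AB}$ (including $\emptyset$) for which this is a rule diagram. The composition $*_{\mathcal D}$ is the bilinear extension of $$\mathfrak d_A*_{\mathcal D}\mathfrak d_B:=\sum_{m_{AB}\in\mathcal M_{\mathfrak d_A}(\mathfrak d_B)}\mathfrak d_A\overset{m_{AB}}{\blacktriangleleft}\mathfrak d_B .$$ *)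

(* Defs.v *)
From HB Require Import structures.
From mathcomp Require Import all_boot all_order all_algebra.
From mathcomp Require Import finmap boolp monalg.

Set Implicit Arguments.
Unset Strict Implicit.
Unset Printing Implicit Defensive.

Import GRing.Theory.
Local Open Scope quotient_scope.
Local Open Scope ring_scope.

(* The type of rule diagrams has to be small enough to be a [choiceType]
   (it indexes the basis of a free module), which fails for records whose
   fields range over all of [finType].  Carriers are therefore finite types
   living in [Set]; every finite set has a copy there. *)

Record sfinType := SFin { sfin_sort :> Set; sfin_class : Finite.axioms_ sfin_sort }.
Canonical sfin_finType (T : sfinType) : finType := Finite.Pack (sfin_class T).
Coercion sfin_finType : sfinType >-> Finite.type.

Definition svoid : sfinType := @SFin void (Finite.class void).

Definition ssum (S T : sfinType) : sfinType :=
  @SFin (sfin_sort S + sfin_sort T)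
        (Finite.class (sfin_finType S + sfin_finType T)%type).

Definition ssub (T : sfinType) (P : pred T) : sfinType :=
  @SFin {x : sfin_sort T | P x} (Finite.class {x : T | P x}).

Section Relations.
Implicit Types A B C : finType.

Definition rcomp A B C (S : {set B * C}) (R : {set A * B}) : {set A * C} :=
  [set p | [exists b, ((p.1, b) \in R) && ((b, p.2) \in S)]].

Definition rstar A (R : {set A * A}) : {set A * A} :=
  [set p | connect [rel x y | (x, y) \in R] p.1 p.2].

Definition one_to_one A B (R : {set A * B}) : Prop :=
  {in R &, forall p q, p <> q -> p.1 <> q.1 /\ p.2 <> q.2}.

(* When [f] and [g] are bijective this is the conjugate relation g o R o f^-1. *)
Definition rimage A B (A' B' : finType) (f : A -> A') (g : B -> B')
    (R : {set A * B}) : {set A' * B'} :=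
  [set (f p.1, g p.2) | p in R].

End Relations.

Record graph := Graph {
  vert : sfinType;
  edge : sfinType;
  src : edge -> vert;
  tgt : edge -> vert }.

Definition graph_empty (G : graph) : Prop := #|vert G| = 0%N /\ #|edge G| = 0%N.

Definition empty_graph : graph := @Graph svoid svoid id id.

Definition graph_sum (G H : graph) : graph :=
  @Graph (ssum (vert G) (vert H)) (ssum (edge G) (edge H))
    (fun e => match e with inl e => inl (src e) | inr e => inr (src e) end)
    (fun e => match e with inl e => inl (tgt e) | inr e => inr (tgt e) end).

Record graph_iso (G H : graph) := GraphIso {
  iso_v : vert G -> vert H;
  iso_e : edge G -> edge H;
  iso_v_bij : bijective iso_v;
  iso_e_bij : bijective iso_e;
  iso_src : forall e, src (iso_e e) = iso_v (src e);
  iso_tgt : forall e, tgt (iso_e e) = iso_v (tgt e) }.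

Record rule := Rule {
  inp : graph;
  out : graph;
  rv : {set vert inp * vert out};
  re : {set edge inp * edge out} }.

Definition linear_rule (R : rule) : Prop :=
  [/\ one_to_one (rv R), one_to_one (re R)
    & forall e e', (e, e') \in re R ->
        (src e, src e') \in rv R /\ (tgt e, tgt e') \in rv R].

Definition rule_empty (R : rule) : Prop :=
  graph_empty (inp R) /\ graph_empty (out R).

Definition rule_sum (R S : rule) : rule :=
  @Rule (graph_sum (inp R) (inp S)) (graph_sum (out R) (out S))
    (rimage inl inl (rv R) :|: rimage inr inr (rv S))
    (rimage inl inl (re R) :|: rimage inr inr (re S)).

(* A decomposition of R as the disjoint union of n rules R_0, ..., R_{n-1},
   given by the index of the summand in which each vertex lies; an edge lies in
   the summand of its endpoints.  The summands may be empty. *)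
Record decomposition (R : rule) (n : nat) := Decomposition {
  lab_inp : vert (inp R) -> 'I_n;
  lab_out : vert (out R) -> 'I_n;
  lab_inp_edge : forall e : edge (inp R), lab_inp (src e) = lab_inp (tgt e);
  lab_out_edge : forall e : edge (out R), lab_out (src e) = lab_out (tgt e);
  lab_rv : forall v w, (v, w) \in rv R -> lab_inp v = lab_out w;
  lab_re : forall e f, (e, f) \in re R -> lab_inp (src e) = lab_out (src f) }.

Definition subgraph (G : graph) n (l : vert G -> 'I_n)
    (lP : forall e : edge G, l (src e) = l (tgt e)) (i : 'I_n) : graph :=
  @Graph (ssub [pred v | l v == i]) (ssub [pred e | l (src e) == i])
    (fun e => exist _ (src (sval e)) (svalP e))
    (fun e => exist _ (tgt (sval e))
                (eq_ind _ (fun j => j == i) (svalP e) _ (lP (sval e)))).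

Definition constituent (R : rule) n (d : decomposition R n) (i : 'I_n) : rule :=
  @Rule (subgraph (lab_inp_edge d) i) (subgraph (lab_out_edge d) i)
    [set p | (sval p.1, sval p.2) \in rv R]
    [set p | (sval p.1, sval p.2) \in re R].

Definition connected (R : rule) : Prop :=
  ~ rule_empty R /\
  ~ (exists d : decomposition R 2, forall i, ~ rule_empty (constituent d i)).

Record prediagram := PreDiagram {
  drule :> rule;
  mv : {set vert (out drule) * vert (inp drule)};
  me : {set edge (out drule) * edge (inp drule)} }.

Definition omega_v (D : prediagram) := rcomp (mv D) (rstar (rcomp (rv D) (mv D))).
Definition omega_e (D : prediagram) := rcomp (me D) (rstar (rcomp (re D) (me D))).

Definition delayed_edge_morphism (D : prediagram) : Prop :=
  forall e e', (e, e') \in omega_e D ->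
    (src e, src e') \in omega_v D /\ (tgt e, tgt e') \in omega_v D.

(* Matches go from the output of the constituent j to the input of the
   constituent i with i < j. *)
Definition is_rule_diagram (D : prediagram) : Prop :=
  (exists n (d : decomposition D n),
     [/\ forall i, linear_rule (constituent d i) /\ connected (constituent d i),
         forall w v, (w, v) \in mv D -> (lab_inp d v < lab_out d w)%N
       & forall f e, (f, e) \in me D ->
           (lab_inp d (src e) < lab_out d (src f))%N])
  /\ [/\ one_to_one (mv D), one_to_one (me D) & delayed_edge_morphism D].

Record rule_diagram := RuleDiagram {
  rd_data :> prediagram;
  rd_axiom : `[< is_rule_diagram rd_data >] }.

HB.instance Definition _ := gen_eqMixin rule_diagram.
HB.instance Definition _ := gen_choiceMixin rule_diagram.

Definition empty_prediagram : prediagram :=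
  @PreDiagram (@Rule empty_graph empty_graph set0 set0) set0 set0.

Lemma empty_prediagramP : `[< is_rule_diagram empty_prediagram >].
Proof.
apply/asboolP; split; last first.
  by split=> [p q | p q |] => [||[]//]; rewrite inE.
unshelve eexists 0%N, (@Decomposition empty_prediagram 0 _ _ _ _ _ _); try by case.
by split=> [[]// | [] | []].
Qed.

Definition empty_diagram : rule_diagram := RuleDiagram empty_prediagramP.

Definition diagram_iso (D D' : prediagram) : Prop :=
  exists (i : graph_iso (inp D) (inp D')) (o : graph_iso (out D) (out D')),
    [/\ rv D' = rimage (iso_v i) (iso_v o) (rv D),
        re D' = rimage (iso_e i) (iso_e o) (re D),
        mv D' = rimage (iso_v o) (iso_v i) (mv D)
      & me D' = rimage (iso_e o) (iso_e i) (me D)].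

Lemma rimage_id (A B : finType) (R : {set A * B}) : rimage id id R = R.
Proof.
apply/setP=> -[a b]; apply/imsetP/idP => [[[x y] xyR [-> ->]]//|abR].
by exists (a, b).
Qed.

Lemma rimage_comp (A B A1 B1 A2 B2 : finType) (f : A -> A1) (g : B -> B1)
    (f' : A1 -> A2) (g' : B1 -> B2) (R : {set A * B}) :
  rimage f' g' (rimage f g R) = rimage (f' \o f) (g' \o g) R.
Proof. by rewrite /rimage -imset_comp; apply: eq_imset. Qed.

Lemma rimageK (A B A' B' : finType) (f : A -> A') (g : B -> B')
    (f' : A' -> A) (g' : B' -> B) (R : {set A * B}) :
  cancel f f' -> cancel g g' -> rimage f' g' (rimage f g R) = R.
Proof.
move=> fK gK; rewrite rimage_comp -[RHS]rimage_id.
by apply: eq_imset => p; rewrite /= fK gK.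
Qed.

Definition graph_iso_refl (G : graph) : graph_iso G G :=
  @GraphIso G G id id (Bijective (fun _ => erefl) (fun _ => erefl))
    (Bijective (fun _ => erefl) (fun _ => erefl)) (fun _ => erefl) (fun _ => erefl).

Lemma graph_iso_trans (G H L : graph) (i : graph_iso G H) (j : graph_iso H L) :
  exists k : graph_iso G L,
    iso_v k = iso_v j \o iso_v i /\ iso_e k = iso_e j \o iso_e i.
Proof.
unshelve eexists (@GraphIso G L (iso_v j \o iso_v i) (iso_e j \o iso_e i) _ _ _ _) => //.
- exact: bij_comp (iso_v_bij _) (iso_v_bij _).
- exact: bij_comp (iso_e_bij _) (iso_e_bij _).
- by move=> e /=; rewrite !iso_src.
- by move=> e /=; rewrite !iso_tgt.
Qed.

Lemma graph_iso_sym (G H : graph) (i : graph_iso G H) :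
  exists j : graph_iso H G,
    cancel (iso_v i) (iso_v j) /\ cancel (iso_e i) (iso_e j).
Proof.
have [f fK Kf] := iso_v_bij i; have [g gK Kg] := iso_e_bij i.
unshelve eexists (@GraphIso H G f g _ _ _ _) => //.
- by exists (iso_v i).
- by exists (iso_e i).
- by move=> e; rewrite -{2}[e]Kg iso_src fK.
- by move=> e; rewrite -{2}[e]Kg iso_tgt fK.
Qed.

Definition diagram_isob (D D' : rule_diagram) : bool := `[< diagram_iso D D' >].

Lemma diagram_isob_refl : reflexive diagram_isob.
Proof.
move=> D; apply/asboolP.
by exists (graph_iso_refl _), (graph_iso_refl _); rewrite !rimage_id.
Qed.

Lemma diagram_isob_sym : symmetric diagram_isob.
Proof.
suff H D D' : diagram_iso D D' -> diagram_iso D' D.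
  by move=> D D'; apply/asboolP/asboolP; exact: H.
move=> [i [o [e1 e2 e3 e4]]].
have [i' [ivK ieK]] := graph_iso_sym i; have [o' [ovK oeK]] := graph_iso_sym o.
by exists i', o'; rewrite e1 e2 e3 e4 !rimageK.
Qed.

Lemma diagram_isob_trans : transitive diagram_isob.
Proof.
move=> D2 D1 D3 /asboolP[i [o [e1 e2 e3 e4]]] /asboolP[i' [o' [f1 f2 f3 f4]]].
apply/asboolP; have [i'' [iv ie]] := graph_iso_trans i i'.
have [o'' [ov oe]] := graph_iso_trans o o'.
by exists i'', o''; rewrite iv ie ov oe f1 f2 f3 f4 e1 e2 e3 e4 !rimage_comp.
Qed.

Canonical diagram_equiv : equiv_rel rule_diagram :=
  EquivRel diagram_isob diagram_isob_refl diagram_isob_sym diagram_isob_trans.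

Definition diagram_class : Type := {eq_quot diagram_equiv}.
HB.instance Definition _ := Quotient.on diagram_class.
HB.instance Definition _ := Choice.on diagram_class.

Definition class_of (D : rule_diagram) : diagram_class := \pi_diagram_class D.

Definition match_rel (A B : prediagram) : finType :=
  ({set vert (out B) * vert (inp A)} * {set edge (out B) * edge (inp A)})%type.

Definition compose (A B : prediagram) (m : match_rel A B) : prediagram :=
  @PreDiagram (rule_sum A B)
    (rimage inl inl (mv A) :|: rimage inr inl m.1 :|: rimage inr inr (mv B))
    (rimage inl inl (me A) :|: rimage inr inl m.2 :|: rimage inr inr (me B)).

Definition is_match (A B : prediagram) : pred (match_rel A B) :=
  fun m => `[< [/\ one_to_one m.1, one_to_one m.2
                 & is_rule_diagram (compose m)] >].

Definition matches (A B : prediagram) : finType := {m : match_rel A B | is_match m}.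

Lemma composeP (A B : prediagram) (m : matches A B) :
  `[< is_rule_diagram (compose (sval m)) >].
Proof. by apply/asboolP; have /asboolP[] := svalP m. Qed.

Definition composite (A B : rule_diagram) (m : matches A B) : rule_diagram :=
  RuleDiagram (composeP m).

Notation rule_diagram_algebra K := {malg K[diagram_class]}.

Definition diagram_unit (K : fieldType) : rule_diagram_algebra K :=
  << class_of empty_diagram >>.

(* Composites are formed on the representatives chosen by [rep], which is meant
   to be a section of [class_of]. *)
Section Product.
Variables (K : fieldType) (rep : diagram_class -> rule_diagram).

Definition mul_basis (a b : diagram_class) : rule_diagram_algebra K :=
  \sum_(m : matches (rep a) (rep b)) << class_of (composite m) >>.

Definition diagram_mul (x y : rule_diagram_algebra K) : rule_diagram_algebra K :=
  \sum_(a <- msupp x) \sum_(b <- msupp y) (x@_a * y@_b) *: mul_basis a b.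

End Product.

(* Main.v *)
(* For three diagrams, both bracketings of a product are sums over the triples of
   match relations m_AB, m_AC, m_BC for which the total composite is a rule diagram;
   the intermediate composites need no separate condition, because a factor of a
   composite that is a rule diagram is again one.  Only the delayed edge morphism
   condition makes this non-trivial: matches in the composite run from B to A and
   never back, so a path of matches and rule pairs with both ends in one factor stays
   in that factor, and omega restricts to it.
   The existence of a decomposition into connected constituents is equivalent to the
   rule being linear and carrying a height function, constant on components and
   strictly decreasing along matches; such a height visibly restricts to factors. *)

Require Import Defs.
From HB Require Import structures.
From mathcomp Require Import all_boot all_order all_algebra.
From mathcomp Require Import finmap boolp monalg.

Set Implicit Arguments.
Unset Strict Implicit.
Unset Printing Implicit Defensive.

Import GRing.Theory.
Local Open Scope ring_scope.

(** * Membership in block relations and in relational composites *)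

Section BlockRelations.

Lemma one_to_oneP (A B : finType) (R : {set A * B}) :
  one_to_one R <->
  (forall a b b', (a, b) \in R -> (a, b') \in R -> b = b') /\
  (forall a a' b, (a, b) \in R -> (a', b) \in R -> a = a').
Proof.
split=> [R11|[Rf Ri] [a b] [a' b'] ab a'b' /= neq].
  split=> [a b b' ab ab'|a a' b ab a'b]; apply: contrapT => neq.
    by have /= [|] := R11 _ _ ab ab'; first by move=> [].
  by have /= [|] := R11 _ _ ab a'b; first by move=> [].
split=> eqx; apply: neq; subst.
  by rewrite (Rf _ _ _ ab a'b').
by rewrite (Ri _ _ _ ab a'b').
Qed.

Lemma mem_rimage (A B A' B' : finType) (f : A -> A') (g : B -> B')
    (R : {set A * B}) a b :
  injective f -> injective g -> ((f a, g b) \in rimage f g R) = ((a, b) \in R).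
Proof.
move=> fI gI; apply/imsetP/idP => [[[x y] xyR [/fI -> /gI ->]] //|abR].
by exists (a, b).
Qed.

Lemma rimage_bij (A B A' B' : finType) (f : A -> A') (g : B -> B')
    (R : {set A * B}) (R' : {set A' * B'}) :
  bijective f -> bijective g ->
  (forall a b, ((f a, g b) \in R') = ((a, b) \in R)) -> R' = rimage f g R.
Proof.
move=> fB gB RR'; apply/setP=> -[a' b'].
have [f' _ Kf] := fB; have [g' _ Kg] := gB.
by rewrite -[a']Kf -[b']Kg RR' mem_rimage //; exact: bij_inj.
Qed.

Lemma in_diag_blocks (A1 A2 B1 B2 : finType) (R : {set A1 * B1})
    (S : {set A2 * B2}) (x : A1 + A2) (y : B1 + B2) :
  ((x, y) \in rimage inl inl R :|: rimage inr inr S) =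
  match x, y with
  | inl a, inl b => (a, b) \in R
  | inr a, inr b => (a, b) \in S
  | _, _ => false
  end.
Proof.
rewrite inE; apply/orP/idP => [[/imsetP[[a b] abR [-> ->]]|
  /imsetP[[a b] abR [-> ->]]] //|].
by case: x y => a [] b // abR; [left|right]; apply/imsetP; exists (a, b).
Qed.

(** The shape of the match relation of a composite: the vanishing block says that outputs of the
    left factor are never matched to inputs of the right one. *)
Lemma in_triangular_blocks (A1 A2 B1 B2 : finType) (R : {set A1 * B1})
    (M : {set A2 * B1}) (S : {set A2 * B2}) (x : A1 + A2) (y : B1 + B2) :
  ((x, y) \in rimage inl inl R :|: rimage inr inl M :|: rimage inr inr S) =
  match x, y with
  | inl a, inl b => (a, b) \in R
  | inr a, inl b => (a, b) \in M
  | inr a, inr b => (a, b) \in S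
  | inl _, inr _ => false
  end.
Proof.
rewrite !inE; apply/orP/idP => [[/orP[]|] /imsetP[[a b] abR [-> ->]] //|].
case: x y => a [] b // abR; [left; apply/orP; left|left; apply/orP; right|right];
  by apply/imsetP; exists (a, b).
Qed.

Lemma in_rcomp (A B C : finType) (S : {set B * C}) (R : {set A * B}) a c :
  reflect (exists2 b, (a, b) \in R & (b, c) \in S) ((a, c) \in rcomp S R).
Proof.
rewrite inE /=; apply: (iffP existsP) => [[b /andP[]]|[b abR bcS]]; exists b => //.
by rewrite abR.
Qed.

Lemma in_rstar (A : finType) (R : {set A * A}) a b :
  ((a, b) \in rstar R) = connect [rel x y | (x, y) \in R] a b.
Proof. by rewrite inE. Qed.

End BlockRelations.

(** * Transport of reachability along a map *)

Section ConnectEmbedding.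
Variables (T U : finType) (e : rel T) (d : rel U) (f : T -> U).

(** The image of [f] is closed under outgoing steps, so a path starting in it can be pulled back one
    step at a time. *)
Lemma connect_fwd : (forall x z, d (f x) z -> exists2 y, z = f y & e x y) ->
  forall x z, connect d (f x) z -> exists2 y, z = f y & connect e x y.
Proof.
move=> stepf x z /connectP[p dp ->{z}].
elim: p x dp => [|z p IHp] x /=; first by exists x.
case/andP=> /stepf[y -> exy] /IHp[w -> cyw]; exists w => //.
exact: connect_trans (connect1 exy) cyw.
Qed.

Lemma connect_homo : (forall x y, e x y -> d (f x) (f y)) ->
  forall x y, connect e x y -> connect d (f x) (f y).
Proof.
move=> ed x y /connectP[p ep ->{y}].
elim: p x ep => [|y p IHp] x //= /andP[/ed exy /IHp].
exact: connect_trans (connect1 exy).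
Qed.

End ConnectEmbedding.

(** The forward statement for the reversed relations. *)
Lemma connect_bwd (T U : finType) (e : rel T) (d : rel U) (f : T -> U) :
  (forall z y, d z (f y) -> exists2 x, z = f x & e x y) ->
  forall z y, connect d z (f y) -> exists2 x, z = f x & connect e x y.
Proof.
move=> stepb z y; rewrite connect_rev.
case/(connect_fwd (e := [rel x y | e y x])) => [x w /stepb[x0]|x -> cxy].
  by exists x0.
by exists x; rewrite // connect_rev.
Qed.

(** * Rule diagrams via height functions *)

(** Locally constant functions on the rule, seen as one graph on all input and output vertices,
    joined by edges and by pairs of [rv]. For a linear rule paired edges then share a value too,
    since their sources are paired. *)
Definition coherent (R : rule) (T : Type)
    (h : vert (inp R) + vert (out R) -> T) : Prop :=
  [/\ forall e : edge (inp R), h (inl (src e)) = h (inl (tgt e)),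
      forall e : edge (out R), h (inr (src e)) = h (inr (tgt e))
    & forall v w, (v, w) \in rv R -> h (inl v) = h (inr w)].

(** The height of an edge is read off at its source; for coherent [h] the target gives the same
    value. *)
Definition match_decreasing (D : prediagram)
    (h : vert (inp D) + vert (out D) -> nat) : Prop :=
  (forall w v, (w, v) \in mv D -> (h (inl v) < h (inr w))%N) /\
  (forall f e, (f, e) \in me D -> (h (inl (src e)) < h (inr (src f)))%N).

Arguments match_decreasing : clear implicits.

Definition decomposition_label (R : rule) n (d : decomposition R n)
    (x : vert (inp R) + vert (out R)) : 'I_n :=
  match x with inl v => lab_inp d v | inr w => lab_out d w end.

Lemma decomposition_label_coherent (R : rule) n (d : decomposition R n) :
  coherent (decomposition_label d).
Proof.
by split=> [e|e|v w] /=; [exact: lab_inp_edge|exact: lab_out_edge|exact: lab_rv].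
Qed.

(** Labels agree across [rv] and [re], so two pairs sharing an entry lie in one constituent, where
    the one-to-one condition applies. *)
Lemma linear_of_constituents (R : rule) n (d : decomposition R n) :
  (forall i, linear_rule (constituent d i)) -> linear_rule R.
Proof.
move=> lin; split.
- apply/one_to_oneP; split=> [a b b'|a a' b] ab ab'.
    have [/one_to_oneP[fun_i _] _ _] := lin (lab_inp d a).
    have pb : lab_out d b == lab_inp d a by rewrite (lab_rv d ab).
    have pb' : lab_out d b' == lab_inp d a by rewrite (lab_rv d ab').
    have := fun_i (exist _ a (eqxx _)) (exist _ b pb) (exist _ b' pb').
    by rewrite !inE /= => /(_ ab ab')[].
  have [/one_to_oneP[_ inj_i] _ _] := lin (lab_out d b).
  have pa : lab_inp d a == lab_out d b by rewrite (lab_rv d ab).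
  have pa' : lab_inp d a' == lab_out d b by rewrite (lab_rv d ab').
  have := inj_i (exist _ a pa) (exist _ a' pa') (exist _ b (eqxx _)).
  by rewrite !inE /= => /(_ ab ab')[].
- apply/one_to_oneP; split=> [a b b'|a a' b] ab ab'.
    have [_ /one_to_oneP[fun_i _] _] := lin (lab_inp d (src a)).
    have pb : lab_out d (src b) == lab_inp d (src a) by rewrite (lab_re d ab).
    have pb' : lab_out d (src b') == lab_inp d (src a) by rewrite (lab_re d ab').
    have := fun_i (exist _ a (eqxx _)) (exist _ b pb) (exist _ b' pb').
    by rewrite !inE /= => /(_ ab ab')[].
  have [_ /one_to_oneP[_ inj_i] _] := lin (lab_out d (src b)).
  have pa : lab_inp d (src a) == lab_out d (src b) by rewrite (lab_re d ab).
  have pa' : lab_inp d (src a') == lab_out d (src b) by rewrite (lab_re d ab').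
  have := inj_i (exist _ a pa) (exist _ a' pa') (exist _ b (eqxx _)).
  by rewrite !inE /= => /(_ ab ab')[].
- move=> e e' ee'; have [_ _ morph_i] := lin (lab_inp d (src e)).
  have pe' : lab_out d (src e') == lab_inp d (src e) by rewrite (lab_re d ee').
  have := morph_i (exist _ e (eqxx _)) (exist _ e' pe').
  by rewrite !inE /=; apply.
Qed.

Lemma constituent_linear (R : rule) n (d : decomposition R n) i :
  linear_rule R -> linear_rule (constituent d i).
Proof.
move=> [/one_to_oneP[Rvf Rvi] /one_to_oneP[Ref Rei] Rmorph]; split.
- apply/one_to_oneP; split=> [a b b'|a a' b]; rewrite !inE /=.
    by move=> ab ab'; apply: val_inj; exact: Rvf ab ab'.
  by move=> ab ab'; apply: val_inj; exact: Rvi ab ab'.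
- apply/one_to_oneP; split=> [a b b'|a a' b]; rewrite !inE /=.
    by move=> ab ab'; apply: val_inj; exact: Ref ab ab'.
  by move=> ab ab'; apply: val_inj; exact: Rei ab ab'.
- by move=> e e'; rewrite !inE /= => /Rmorph.
Qed.

(** * Connected components of a rule *)

Section Components.
Variable R : rule.
Local Notation V := (vert (inp R) + vert (out R))%type.

(** Two-valued test functions mirror [connected], which forbids splittings into two non-empty
    parts. *)
Definition same_component (x y : V) : bool :=
  `[< forall f : V -> bool, coherent f -> f x = f y >].

(** Composing [h] with the indicator of the value [h y] reduces to a Boolean coherent function. *)
Lemma coherent_component (T : eqType) (h : V -> T) x y :
  coherent h -> same_component x y -> h x = h y.
Proof.
move=> [hi ho hr] /asboolP/(_ (fun z => h z == h y)); rewrite eqxx => eqxy.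
by apply/eqP; apply: eqxy; split=> [e|e|v w vw]; rewrite ?hi ?ho ?(hr v w).
Qed.

(** As subsets, components live in a finite type, and their [enum_rank] can serve to number them. *)
Definition component (x : V) : {set V} := [set y | same_component x y].

Lemma eq_componentP x y : component x = component y <-> same_component x y.
Proof.
split=> [/setP/(_ y)|/asboolP xy].
  by rewrite !inE => ->; apply/asboolP.
apply/setP=> z; rewrite !inE.
by apply/idP/idP => /asboolP yz; apply/asboolP=> f cf; rewrite -yz // xy.
Qed.

Lemma component_coherent : coherent component.
Proof.
split=> [e|e|v w vw]; apply/eq_componentP/asboolP => f [fi fo fr].
- exact: fi.
- exact: fo.
- exact: fr.
Qed.

End Components.

Lemma not_graph_empty (G : graph) : vert G -> ~ graph_empty G.
Proof. by move=> v [/card0_eq/(_ v)]. Qed.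

(** An edge lies in the constituent of its source, so a constituent without vertices has no edges
    either. *)
Lemma constituent_nonemptyP (R : rule) n (d : decomposition R n) i :
  ~ rule_empty (constituent d i) <-> exists x, decomposition_label d x = i.
Proof.
split=> [nonempty|[[v|w] /= /eqP lab_i]]; last 2 first.
- by case=> /(@not_graph_empty (inp (constituent d i)) (exist _ v lab_i)).
- by case=> _ /(@not_graph_empty (out (constituent d i)) (exist _ w lab_i)).
apply: contrapT => none; apply: nonempty; split; split.
- apply/eq_card0 => -[v vi]; case: none; exists (inl v); exact/eqP.
- apply/eq_card0 => -[e ei]; case: none; exists (inl (src e)); exact/eqP.
- apply/eq_card0 => -[v vi]; case: none; exists (inr v); exact/eqP.
- apply/eq_card0 => -[e ei]; case: none; exists (inr (src e)); exact/eqP.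
Qed.

(* A splitting of the constituent i extends, by a constant value on all other
   constituents, to a coherent function on the whole rule. *)
Lemma connected_constituent (R : rule) n (d : decomposition R n) i :
  (exists x, decomposition_label d x = i) ->
  (forall x y, decomposition_label d x = i -> decomposition_label d y = i ->
     same_component x y) ->
  connected (constituent d i).
Proof.
move=> inhab conn; split; first exact/constituent_nonemptyP.
move=> [d2 nonempty].
pose f x := match x with
  | inl v => if insub v is Some u then lab_inp d2 u == ord0 else false
  | inr w => if insub w is Some u then lab_out d2 u == ord0 else false
  end.
have finl (u : vert (inp (constituent d i))) :
    f (inl (sval u)) = (lab_inp d2 u == ord0).
  by case: u => v p; rewrite /f insubT; congr (lab_inp d2 _ == _); exact: val_inj.
have finr (u : vert (out (constituent d i))) :
    f (inr (sval u)) = (lab_out d2 u == ord0).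
  by case: u => v p; rewrite /f insubT; congr (lab_out d2 _ == _); exact: val_inj.
have fout x : decomposition_label d x != i -> f x = false.
  by case: x => v /= vi; rewrite insubF //; exact: negbTE.
have [di do_ dr] := decomposition_label_coherent d.
have fcoh : coherent f.
  split=> [e|e|v w vw].
  - have [si|sNi] := boolP (lab_inp d (src e) == i); last by rewrite !fout // -di.
    pose u : edge (inp (constituent d i)) := exist _ e si.
    by have := finl (src u); have := finl (tgt u); rewrite lab_inp_edge /= => <-.
  - have [si|sNi] := boolP (lab_out d (src e) == i); last by rewrite !fout // -do_.
    pose u : edge (out (constituent d i)) := exist _ e si.
    by have := finr (src u); have := finr (tgt u); rewrite lab_out_edge /= => <-.
  - have [vi|vNi] := boolP (lab_inp d v == i); last by rewrite !fout // -(dr v w).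
    have wi : lab_out d w == i by rewrite -(lab_rv d vw).
    have := finl (exist _ v vi); have := finr (exist _ w wi).
    by rewrite -(@lab_rv _ _ d2 (exist _ v vi)) ?inE //= => <-.
(* Both halves of the splitting are non-empty, so [f] takes both truth values on constituent [i],
   against [conn]. *)
have fval (j : 'I_2) : exists2 x, decomposition_label d x = i & f x = (j == ord0).
  have /constituent_nonemptyP[[[v vi]|[v vi]] <-] := nonempty j.
    by exists (inl v); [exact/eqP|exact: (finl (exist _ v vi))].
  by exists (inr v); [exact/eqP|exact: (finr (exist _ v vi))].
have [x xi fx] := fval ord0; have [y yi fy] := fval (lift ord0 ord0).
by have := coherent_component fcoh (conn x y xi yi); rewrite fx fy.
Qed.

Lemma index_sort_ltn (s : seq nat) a b : a \in s -> b \in s -> (a < b)%N ->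
  (index a (sort leq s) < index b (sort leq s))%N.
Proof.
move=> sa sb ab; have srt := sort_sorted leq_total s.
rewrite ltnNge; apply/negP => le_ba.
have := sorted_leq_index leq_trans leqnn srt; move/(_ b a).
by rewrite !mem_sort sa sb => /(_ isT isT le_ba); rewrite leqNgt ab.
Qed.

(** The label of [x] is the position of its key in the sorted duplicate-free list of all keys.
    Surjectivity will make every constituent non-empty. *)
Lemma rank_ordinal (T : finType) (key : T -> nat) :
  exists n (lab : T -> 'I_n),
    [/\ forall i, exists x, lab x = i,
        forall x y, lab x = lab y <-> key x = key y
      & forall x y, (key x < key y)%N -> (lab x < lab y)%N].
Proof.
pose keys := undup [seq key x | x <- enum T]; pose s := sort leq keys.
have key_in x : key x \in keys by rewrite mem_undup map_f // mem_enum.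
have idx_lt x : (index (key x) s < size s)%N by rewrite index_mem mem_sort key_in.
exists (size s), (fun x => Ordinal (idx_lt x)); split=> [i|x y|x y] /=.
- have : nth 0%N s i \in keys by rewrite -(mem_sort leq) mem_nth.
  rewrite mem_undup => /mapP[x _ eqx]; exists x.
  by apply: val_inj; rewrite /= -eqx index_uniq // sort_uniq undup_uniq.
- split=> [[] eqi|eqk]; last by apply: val_inj; rewrite /= eqk.
  rewrite -[key x](@nth_index _ 0%N _ s) ?mem_sort //.
  by rewrite -[key y](@nth_index _ 0%N _ s) ?mem_sort // eqi.
- exact: index_sort_ltn.
Qed.

(** A numbering of the constituents is itself a height. Conversely, the components, numbered in
    order of increasing height, are the constituents of a decomposition. *)
Lemma stratifiedP (D : prediagram) :
  is_rule_diagram D <->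
  [/\ linear_rule D, exists2 h, coherent h & match_decreasing D h,
      one_to_one (mv D), one_to_one (me D) & delayed_edge_morphism D].
Proof.
split=> [[[n [d [lc mvd med]]] [mv1 me1 del]]|[lin [h hcoh [hmv hme]] mv1 me1 del]].
  split=> //; first by apply: (linear_of_constituents (d := d)) => i; have [] := lc i.
  exists (fun x => nat_of_ord (decomposition_label d x)); last by split.
  have [di do_ dr] := decomposition_label_coherent d.
  by split=> [e|e|v w vw]; congr nat_of_ord; [exact: di|exact: do_|exact: dr].
split=> //.
(* Refines the height so that it separates the connected components. *)
pose key x := (h x * #|{set vert (inp D) + vert (out D)}|
               + enum_rank (component x))%N.
have key_lt x y : (h x < h y)%N -> (key x < key y)%N.
  move=> hxy; rewrite /key.
  apply: (@leq_trans ((h x).+1 * #|{set vert (inp D) + vert (out D)}|)%N).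
    by rewrite mulSn addnC ltn_add2r.
  by apply: leq_trans (leq_addr _ _); rewrite leq_mul2r hxy orbT.
have key_comp x y : key x = key y -> same_component x y.
  move=> eqk; apply/eq_componentP; apply: enum_rank_inj; apply: val_inj => /=.
  (* Modulo the number of vertex sets the height term vanishes and the rank of the component
     remains. *)
  have : (key x %% #|{set vert (inp D) + vert (out D)}| =
          key y %% #|{set vert (inp D) + vert (out D)}|)%N by rewrite eqk.
  by rewrite !modnMDl !modn_small.
have key_coh : coherent key.
  have [hi ho hr] := hcoh; have [ci co cr] := component_coherent D.
  by split=> [e|e|v w vw]; rewrite /key ?hi ?ho ?(hr v w) ?ci ?co ?(cr v w).
have [n [lab [lab_surj lab_key lab_lt]]] :=
  rank_ordinal (T := (vert (inp D) + vert (out D))%type) key.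
have [ki ko kr] := key_coh; have [_ _ re_morph] := lin.
unshelve eexists n, (@Decomposition D n (lab \o inl) (lab \o inr) _ _ _ _).
- by move=> e; apply/lab_key; rewrite /= ki.
- by move=> e; apply/lab_key; rewrite /= ko.
- by move=> v w vw; apply/lab_key; rewrite /= (kr v w).
- by move=> e f /re_morph[ef _]; apply/lab_key; rewrite /= (kr _ _ ef).
set d := Decomposition _ _ _ _.
have labE x : decomposition_label d x = lab x by case: x.
split=> [i|w v wv|f e fe].
- split; first exact: constituent_linear.
  apply: connected_constituent => [|x y].
    by have [x labx] := lab_surj i; exists x; rewrite labE.
  by rewrite !labE => <- /esym/lab_key/key_comp.
- exact/lab_lt/key_lt/hmv.
- exact/lab_lt/key_lt/hme.
Qed.

(** * Embeddings of diagrams and factors of composites *)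

(** Inclusion of an induced subdiagram: relations are preserved and reflected, but paths of matches
    and rule pairs may still leave the image. *)
Record embedding (A X : prediagram) := Embedding {
  emb_iv : vert (inp A) -> vert (inp X);
  emb_ie : edge (inp A) -> edge (inp X);
  emb_ov : vert (out A) -> vert (out X);
  emb_oe : edge (out A) -> edge (out X);
  emb_iv_inj : injective emb_iv;
  emb_ie_inj : injective emb_ie;
  emb_ov_inj : injective emb_ov;
  emb_oe_inj : injective emb_oe;
  emb_isrc : forall e, src (emb_ie e) = emb_iv (src e);
  emb_itgt : forall e, tgt (emb_ie e) = emb_iv (tgt e);
  emb_osrc : forall e, src (emb_oe e) = emb_ov (src e);
  emb_otgt : forall e, tgt (emb_oe e) = emb_ov (tgt e);
  emb_rv : forall v w, ((emb_iv v, emb_ov w) \in rv X) = ((v, w) \in rv A);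
  emb_re : forall e f, ((emb_ie e, emb_oe f) \in re X) = ((e, f) \in re A);
  emb_mv : forall w v, ((emb_ov w, emb_iv v) \in mv X) = ((w, v) \in mv A);
  emb_me : forall f e, ((emb_oe f, emb_ie e) \in me X) = ((f, e) \in me A) }.

Section EmbeddingTheory.
Variables (A X : prediagram) (i : embedding A X).

Lemma one_to_one_preimage (S T S' T' : finType) (f : S -> S') (g : T -> T')
    (R : {set S * T}) (R' : {set S' * T'}) :
  injective f -> injective g ->
  (forall a b, ((f a, g b) \in R') = ((a, b) \in R)) ->
  one_to_one R' -> one_to_one R.
Proof.
move=> fI gI RR' /one_to_oneP[R'f R'i]; apply/one_to_oneP.
split=> [a b b'|a a' b]; rewrite -!RR' => ab ab'.
  exact/gI/(R'f _ _ _ ab ab').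
exact/fI/(R'i _ _ _ ab ab').
Qed.

Lemma omega_e_embedding f e :
  (f, e) \in omega_e A -> (emb_oe i f, emb_ie i e) \in omega_e X.
Proof.
case/in_rcomp => f'; rewrite in_rstar => ff' f'e.
apply/in_rcomp; exists (emb_oe i f'); last by rewrite emb_me.
rewrite in_rstar; apply: connect_homo ff' => f1 f2 /in_rcomp[e1 m1 r1].
by apply/in_rcomp; exists (emb_ie i e1); rewrite ?emb_me ?emb_re.
Qed.

(** Linearity, height and one-to-one matches restrict directly. For the delayed condition, [omega_e]
    pushes forward to [X], and the resulting vertex pairs are pulled back by the convexity
    hypothesis on [omega_v]. *)
Lemma embedded_rule_diagram :
  (forall w v, (emb_ov i w, emb_iv i v) \in omega_v X -> (w, v) \in omega_v A) ->
  is_rule_diagram X -> is_rule_diagram A.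
Proof.
move=> convex /stratifiedP[[rv1 re1 rmor] [h [hi ho hr] [hmv hme]] mv1 me1 del].
apply/stratifiedP; split.
- split.
  + by apply: one_to_one_preimage rv1; [exact: emb_iv_inj|exact: emb_ov_inj|exact: emb_rv].
  + by apply: one_to_one_preimage re1; [exact: emb_ie_inj|exact: emb_oe_inj|exact: emb_re].
  + move=> e f; rewrite -(emb_re i) => /rmor.
    by rewrite emb_isrc emb_itgt emb_osrc emb_otgt !emb_rv.
- exists (fun x => match x with
                   | inl v => h (inl (emb_iv i v))
                   | inr w => h (inr (emb_ov i w)) end).
    split=> [e|e|v w]; rewrite -?emb_isrc -?emb_itgt -?emb_osrc -?emb_otgt //.
    by rewrite -(emb_rv i) => /hr.
  split=> [w v|f e]; first by rewrite -(emb_mv i) => /hmv.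
  by rewrite -(emb_me i) => /hme; rewrite emb_isrc emb_osrc.
- by apply: one_to_one_preimage mv1; [exact: emb_ov_inj|exact: emb_iv_inj|exact: emb_mv].
- by apply: one_to_one_preimage me1; [exact: emb_oe_inj|exact: emb_ie_inj|exact: emb_me].
- move=> f e /omega_e_embedding/del.
  by rewrite emb_isrc emb_itgt emb_osrc emb_otgt => -[/convex ? /convex ?].
Qed.

(** If matches and rule pairs starting in the image end in it, an alternating path that begins in
    the image never leaves it. *)
Lemma omega_v_forward :
  (forall w v, (emb_ov i w, v) \in mv X -> exists v', v = emb_iv i v') ->
  (forall v w, (emb_iv i v, w) \in rv X -> exists w', w = emb_ov i w') ->
  forall w v, (emb_ov i w, emb_iv i v) \in omega_v X -> (w, v) \in omega_v A.
Proof.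
move=> mcl rcl w v /in_rcomp[x]; rewrite in_rstar.
case/(connect_fwd (e := [rel w w' | (w, w') \in rcomp (rv A) (mv A)])) => [w1 w2|w' ->].
  case/in_rcomp => y wy yw2; have [v1 eqy] := mcl _ _ wy; subst y.
  have [w3 eqw] := rcl _ _ yw2; subst w2; exists w3 => //=.
  by apply/in_rcomp; exists v1; rewrite -?(emb_mv i) -?(emb_rv i).
move=> cww'; rewrite emb_mv => w'v; apply/in_rcomp; exists w' => //.
by rewrite in_rstar.
Qed.

(** The dual criterion: the image is closed under incoming steps, and the path is traced back from
    its end. *)
Lemma omega_v_backward :
  (forall w v, (w, emb_iv i v) \in mv X -> exists w', w = emb_ov i w') ->
  (forall v w, (v, emb_ov i w) \in rv X -> exists v', v = emb_iv i v') ->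
  forall w v, (emb_ov i w, emb_iv i v) \in omega_v X -> (w, v) \in omega_v A.
Proof.
move=> mcl rcl w v /in_rcomp[x] + xv; rewrite in_rstar.
(* The last match ends in the image, hence starts there, which gives the point from which the rest
   of the path is traced back. *)
have [w' eqx] := mcl _ _ xv; subst x.
case/(connect_bwd (e := [rel w w' | (w, w') \in rcomp (rv A) (mv A)])) => [w1 w2|w0].
  case/in_rcomp => y wy yw2; have [v1 eqy] := rcl _ _ yw2; subst y.
  have [w3 eqw] := mcl _ _ wy; subst w1; exists w3 => //=.
  by apply/in_rcomp; exists v1; rewrite -?(emb_mv i) -?(emb_rv i).
move/emb_ov_inj => <- cww'; rewrite emb_mv in xv.
by apply/in_rcomp; exists w'; rewrite ?in_rstar.
Qed.

End EmbeddingTheory.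

(* Matches never leave the left factor, nor do they enter the right one. *)
Lemma left_factor_rule_diagram (A B : prediagram) (m : match_rel A B) :
  is_rule_diagram (compose m) -> is_rule_diagram A.
Proof.
unshelve eapply embedded_rule_diagram; last apply: omega_v_forward.
  unshelve eapply (@Embedding A (compose m) inl inl inl inl) => //;
    try exact: inl_inj; move=> x y; rewrite ?in_diag_blocks ?in_triangular_blocks //.
- by move=> w [v|v] /=; rewrite in_triangular_blocks //; exists v.
- by move=> w [v|v] /=; rewrite in_diag_blocks //; exists v.
Qed.

Lemma right_factor_rule_diagram (A B : prediagram) (m : match_rel A B) :
  is_rule_diagram (compose m) -> is_rule_diagram B.
Proof.
unshelve eapply embedded_rule_diagram; last apply: omega_v_backward.
  unshelve eapply (@Embedding B (compose m) inr inr inr inr) => //;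
    try exact: inr_inj; move=> x y; rewrite ?in_diag_blocks ?in_triangular_blocks //.
- by move=> [v|v] w /=; rewrite in_triangular_blocks //; exists v.
- by move=> [v|v] w /=; rewrite in_diag_blocks //; exists v.
Qed.

Lemma diagram_iso_sym (D D' : prediagram) : diagram_iso D D' -> diagram_iso D' D.
Proof.
move=> [i [o [e1 e2 e3 e4]]].
have [i' [ivK ieK]] := graph_iso_sym i; have [o' [ovK oeK]] := graph_iso_sym o.
by exists i', o'; rewrite e1 e2 e3 e4 !rimageK.
Qed.

(** An isomorphism is an embedding onto everything, so its image is trivially closed under steps. *)
Lemma iso_rule_diagram (D D' : prediagram) :
  diagram_iso D D' -> is_rule_diagram D' -> is_rule_diagram D.
Proof.
move=> [i [o [rvE reE mvE meE]]].
have ivI := bij_inj (iso_v_bij i); have ieI := bij_inj (iso_e_bij i).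
have ovI := bij_inj (iso_v_bij o); have oeI := bij_inj (iso_e_bij o).
unshelve eapply embedded_rule_diagram; last apply: omega_v_forward.
  unshelve eapply (@Embedding D D' (iso_v i) (iso_e i) (iso_v o) (iso_e o)) => //;
    try exact: iso_src; try exact: iso_tgt.
  - by move=> v w; rewrite rvE mem_rimage.
  - by move=> v w; rewrite reE mem_rimage.
  - by move=> v w; rewrite mvE mem_rimage.
  - by move=> v w; rewrite meE mem_rimage.
- by move=> w v _; have [g _ gK] := iso_v_bij i; exists (g v); rewrite /= gK.
- by move=> w v _; have [g _ gK] := iso_v_bij o; exists (g v); rewrite /= gK.
Qed.

(** * Isomorphisms of composites *)

Lemma diagram_isoP (D D' : prediagram) (i : graph_iso (inp D) (inp D'))
    (o : graph_iso (out D) (out D')) :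
  (forall v w, ((iso_v i v, iso_v o w) \in rv D') = ((v, w) \in rv D)) ->
  (forall e f, ((iso_e i e, iso_e o f) \in re D') = ((e, f) \in re D)) ->
  (forall w v, ((iso_v o w, iso_v i v) \in mv D') = ((w, v) \in mv D)) ->
  (forall f e, ((iso_e o f, iso_e i e) \in me D') = ((f, e) \in me D)) ->
  diagram_iso D D'.
Proof.
by move=> rvE reE mvE meE; exists i, o; split; apply: rimage_bij => //;
  (exact: iso_v_bij || exact: iso_e_bij).
Qed.

Definition sum_map (S T S' T' : Type) (f : S -> S') (g : T -> T') (x : S + T) :
    S' + T' :=
  match x with inl a => inl (f a) | inr b => inr (g b) end.

Definition sum_assoc (S T U : Type) (x : (S + T) + U) : S + (T + U) :=
  match x with
  | inl (inl a) => inl a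
  | inl (inr b) => inr (inl b)
  | inr c => inr (inr c)
  end.

Lemma sum_map_bij (S T S' T' : Type) (f : S -> S') (g : T -> T') :
  bijective f -> bijective g -> bijective (sum_map f g).
Proof.
move=> [f' fK f'K] [g' gK g'K]; exists (sum_map f' g') => -[a|b] /=;
  by rewrite ?fK ?gK ?f'K ?g'K.
Qed.

Lemma sum_assoc_bij (S T U : Type) : bijective (@sum_assoc S T U).
Proof.
by exists (fun x => match x with
  | inl a => inl (inl a)
  | inr (inl b) => inl (inr b)
  | inr (inr c) => inr c end) => [[[]|]|[|[]]].
Qed.

Definition graph_iso_sum (G H G' H' : graph) (i : graph_iso G G')
    (j : graph_iso H H') : graph_iso (graph_sum G H) (graph_sum G' H').
Proof.
exists (sum_map (iso_v i) (iso_v j)) (sum_map (iso_e i) (iso_e j)).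
- exact: sum_map_bij (iso_v_bij i) (iso_v_bij j).
- exact: sum_map_bij (iso_e_bij i) (iso_e_bij j).
- by move=> [e|e] /=; rewrite iso_src.
- by move=> [e|e] /=; rewrite iso_tgt.
Defined.

Definition graph_iso_assoc (G H L : graph) :
  graph_iso (graph_sum (graph_sum G H) L) (graph_sum G (graph_sum H L)).
Proof.
exists (@sum_assoc _ _ _) (@sum_assoc _ _ _).
- exact: sum_assoc_bij.
- exact: sum_assoc_bij.
- by move=> [[e|e]|e].
- by move=> [[e|e]|e].
Defined.

Definition graph_iso_empty_sum (G : graph) :
  graph_iso G (graph_sum empty_graph G).
Proof.
exists inr inr => //.
- by exists (fun x => match x with inl v => of_void _ v | inr a => a end) => [|[[]|]].
- by exists (fun x => match x with inl v => of_void _ v | inr a => a end) => [|[[]|]].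
Defined.

Definition graph_iso_sum_empty (G : graph) :
  graph_iso G (graph_sum G empty_graph).
Proof.
exists inl inl => //.
- by exists (fun x => match x with inr v => of_void _ v | inl a => a end) => [|[|[]]].
- by exists (fun x => match x with inr v => of_void _ v | inl a => a end) => [|[|[]]].
Defined.

(** Conjugating [m] by the isomorphisms of the factors gives the off-diagonal block that their sum
    respects. *)
Lemma compose_iso (A A' B B' : prediagram) (iA : graph_iso (inp A) (inp A'))
    (oA : graph_iso (out A) (out A')) (iB : graph_iso (inp B) (inp B'))
    (oB : graph_iso (out B) (out B')) (m : match_rel A B) :
  rv A' = rimage (iso_v iA) (iso_v oA) (rv A) ->
  re A' = rimage (iso_e iA) (iso_e oA) (re A) ->
  mv A' = rimage (iso_v oA) (iso_v iA) (mv A) ->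
  me A' = rimage (iso_e oA) (iso_e iA) (me A) ->
  rv B' = rimage (iso_v iB) (iso_v oB) (rv B) ->
  re B' = rimage (iso_e iB) (iso_e oB) (re B) ->
  mv B' = rimage (iso_v oB) (iso_v iB) (mv B) ->
  me B' = rimage (iso_e oB) (iso_e iB) (me B) ->
  diagram_iso (compose m)
    (compose ((rimage (iso_v oB) (iso_v iA) m.1,
               rimage (iso_e oB) (iso_e iA) m.2) : match_rel A' B')).
Proof.
move=> rvA reA mvA meA rvB reB mvB meB.
have := (bij_inj (iso_v_bij iA), bij_inj (iso_e_bij iA),
         bij_inj (iso_v_bij oA), bij_inj (iso_e_bij oA)).
have := (bij_inj (iso_v_bij iB), bij_inj (iso_e_bij iB),
         bij_inj (iso_v_bij oB), bij_inj (iso_e_bij oB)).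
move=> [[[ivB ieB] ovB] oeB] [[[ivA ieA] ovA] oeA].
apply: (@diagram_isoP (compose m) (compose _) (graph_iso_sum iA iB) (graph_iso_sum oA oB)).
- by move=> [a|a] [b|b] /=; rewrite !in_diag_blocks // ?rvA ?rvB mem_rimage.
- by move=> [a|a] [b|b] /=; rewrite !in_diag_blocks // ?reA ?reB mem_rimage.
- by move=> [a|a] [b|b] /=; rewrite !in_triangular_blocks // ?mvA ?mvB mem_rimage.
- by move=> [a|a] [b|b] /=; rewrite !in_triangular_blocks // ?meA ?meB mem_rimage.
Qed.

(** * Reassociating the matches of a triple composite *)

Section ReassociateMatches.
Variables A B C A' B' : finType.

(* A for the inputs of the first diagram, B and B' for the outputs and inputs of
   the second, C for the outputs of the third. *)
Definition right_matches (p : {set B * A} * {set C * (A + B')}) :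
    {set C * B'} * {set (B + C) * A} :=
  ([set q | (q.1, inr q.2) \in p.2],
   [set q | match q.1 with
            | inl b => (b, q.2) \in p.1
            | inr c => (c, inl q.2) \in p.2 end]).

Definition left_matches (p : {set C * B'} * {set (B + C) * A}) :
    {set B * A} * {set C * (A + B')} :=
  ([set q | (inl q.1, q.2) \in p.2],
   [set q | match q.2 with
            | inl a => (inr q.1, a) \in p.2
            | inr b => (q.1, b) \in p.1 end]).

Lemma right_matchesK : cancel right_matches left_matches.
Proof.
move=> [R S]; congr pair; apply/setP=> -[x y]; rewrite !inE //=.
by case: y => y; rewrite inE.
Qed.

Lemma left_matchesK : cancel left_matches right_matches.
Proof.
move=> [R S]; congr pair; apply/setP=> -[x y]; rewrite !inE //=.
by case: x => x; rewrite inE.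
Qed.

End ReassociateMatches.

(** Both composites consist of the factors and three match blocks, B to A, C to A and C to B. The
    hypotheses identify these blocks, so reassociating the disjoint unions is an isomorphism. *)
Lemma compose_assoc_iso (A B C : prediagram) (m : match_rel A B)
    (m' : match_rel (compose m) C) (n : match_rel B C)
    (n' : match_rel A (compose n)) :
  (n.1, n'.1) = right_matches (m.1, m'.1) ->
  (n.2, n'.2) = right_matches (m.2, m'.2) ->
  diagram_iso (compose m') (compose n').
Proof.
rewrite /right_matches /= => -[nv nv'] [ne ne'].
apply: (@diagram_isoP (compose m') (compose n')
  (graph_iso_assoc (inp A) (inp B) (inp C))
  (graph_iso_assoc (out A) (out B) (out C))).
- by move=> [[a|a]|a] [[b|b]|b] /=; rewrite !in_diag_blocks ?in_diag_blocks.
- by move=> [[a|a]|a] [[b|b]|b] /=; rewrite !in_diag_blocks ?in_diag_blocks.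
- by move=> [[a|a]|a] [[b|b]|b] /=;
    rewrite !in_triangular_blocks ?in_triangular_blocks ?nv ?nv' ?inE.
- by move=> [[a|a]|a] [[b|b]|b] /=;
    rewrite !in_triangular_blocks ?in_triangular_blocks ?ne ?ne' ?inE.
Qed.

Lemma compose_empty_l_iso (A : prediagram) (m : match_rel empty_prediagram A) :
  diagram_iso A (compose m).
Proof.
apply: (@diagram_isoP A (compose m) (graph_iso_empty_sum _) (graph_iso_empty_sum _));
  by move=> a b; rewrite ?in_diag_blocks ?in_triangular_blocks.
Qed.

Lemma compose_empty_r_iso (A : prediagram) (m : match_rel A empty_prediagram) :
  diagram_iso A (compose m).
Proof.
apply: (@diagram_isoP A (compose m) (graph_iso_sum_empty _) (graph_iso_sum_empty _));
  by move=> a b; rewrite ?in_diag_blocks ?in_triangular_blocks.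
Qed.

(** * The algebra *)

Lemma linear_fun_sum (K : fieldType) (V W : lmodType K) (g : V -> W)
    (I : Type) (r : seq I) (F : I -> V) :
  linear g -> g (\sum_(i <- r) F i) = \sum_(i <- r) g (F i).
Proof.
move=> glin.
pose gL : {linear V -> W} := HB.pack g (GRing.isLinear.Build _ _ _ _ g glin).
exact: (raddf_sum gL).
Qed.

(** * Linear maps on a free module *)

Section LinearExtension.
Variables (K : fieldType) (T : choiceType) (V : lmodType K).

Definition linear_extension (f : T -> V) (x : {malg K[T]}) : V :=
  \sum_(a <- msupp x) x@_a *: f a.

(** Supports vary with the vector; a common larger index set allows sums for different vectors to be
    added termwise. *)
Lemma linear_extensionEw f (d : {fset T}) x : (msupp x `<=` d)%fset ->
  linear_extension f x = \sum_(a <- d) x@_a *: f a.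
Proof.
move=> le_d; apply: big_fset_incl => // a _ /mcoeff_outdom ->.
by rewrite scale0r.
Qed.

Lemma linear_extension_linear f : linear (linear_extension f).
Proof.
move=> c x y; pose d := (msupp (c *: x + y) `|` (msupp x `|` msupp y))%fset.
rewrite !(@linear_extensionEw f d) ?fsubsetUl //; last 2 first.
- by rewrite /d fsubsetU // fsubsetUr orbT.
- by rewrite /d fsubsetU // fsubsetUl orbT.
rewrite scaler_sumr -big_split; apply: eq_bigr => a _ /=.
by rewrite mcoeffD mcoeffZ scalerDl scalerA.
Qed.

Lemma linear_extensionU f a : linear_extension f << a >> = f a.
Proof.
by rewrite (linear_extensionEw f msuppU_le) big_seq_fset1 mcoeffUU scale1r.
Qed.

Lemma linear_extension_uniq (g : {malg K[T]} -> V) :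
  linear g -> forall x, g x = linear_extension (fun a => g << a >>) x.
Proof.
move=> glin x.
rewrite {1}[x]monalgE linear_fun_sum //; apply: eq_bigr => a _.
have -> : << x@_a *g a >> = x@_a *: << a >> :> {malg K[T]}.
  by apply/malgP => b; rewrite mcoeffZ !mcoeffU mulrnAr mulr1.
have g0 : g 0 = 0 by have := glin (-1) 0 0; rewrite scaler0 addr0 scaleN1r addNr.
by have := glin x@_a << a >> 0; rewrite g0 !addr0.
Qed.

Lemma eq_linear_basis (g h : {malg K[T]} -> V) :
  linear g -> linear h -> (forall a, g << a >> = h << a >>) -> g =1 h.
Proof.
move=> glin hlin gh x; rewrite (linear_extension_uniq glin) (linear_extension_uniq hlin).
by apply: eq_bigr => a _; rewrite gh.
Qed.

End LinearExtension.

Section DiagramAlgebra.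
Variable K : fieldType.
Local Notation algebra := (rule_diagram_algebra K).

(* With the value zero on invalid diagrams, products become sums over all pairs of
   relations, and these can be reassociated without side conditions. *)
Definition diagram_vector (D : prediagram) : algebra :=
  match pselect (is_rule_diagram D) with
  | left p => << class_of (RuleDiagram (asboolT p)) >>
  | right _ => 0
  end.

Lemma class_of_eq (D D' : rule_diagram) :
  diagram_iso D D' -> class_of D = class_of D'.
Proof. by move=> iso; apply/eqP; rewrite eqmodE; apply/asboolP. Qed.

Lemma diagram_iso_refl (D : prediagram) : diagram_iso D D.
Proof. by exists (graph_iso_refl _), (graph_iso_refl _); rewrite !rimage_id. Qed.

(** The two validity proofs may differ, but the identity isomorphism gives equal classes. *)
Lemma diagram_vectorE (D : rule_diagram) : diagram_vector D = << class_of D >>.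
Proof.
rewrite /diagram_vector; case: pselect => [p|[]]; last exact/asboolP/rd_axiom.
by congr (<< _ >>); apply: class_of_eq; exact: diagram_iso_refl.
Qed.

Lemma diagram_vector0 (D : prediagram) : ~ is_rule_diagram D -> diagram_vector D = 0.
Proof. by rewrite /diagram_vector; case: pselect. Qed.

Lemma diagram_vector_iso (D D' : prediagram) :
  diagram_iso D D' -> diagram_vector D = diagram_vector D'.
Proof.
move=> iso; have [Dok|Dnot] := pselect (is_rule_diagram D).
  have D'ok := iso_rule_diagram (diagram_iso_sym iso) Dok.
  rewrite (diagram_vectorE (RuleDiagram (asboolT Dok))).
  rewrite (diagram_vectorE (RuleDiagram (asboolT D'ok))).
  by congr (<< _ >>); exact: class_of_eq.
by rewrite !diagram_vector0 // => /(iso_rule_diagram iso).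
Qed.

Definition diagram_product (A B : prediagram) : algebra :=
  \sum_(m : match_rel A B) diagram_vector (compose m).

(** As a block of the match relations of the composite, [m] inherits the one-to-one property from
    them. *)
Lemma is_matchE (A B : prediagram) (m : match_rel A B) :
  is_match m = `[< is_rule_diagram (compose m) >].
Proof.
apply/asboolP/asboolP => [[]//|mok]; split=> //.
  have [_ [/one_to_oneP[mf mi] _ _]] := mok; apply/one_to_oneP.
  split=> [a b b'|a a' b] ab ab'.
    have := mf (inr a) (inl b) (inl b').
    by rewrite !in_triangular_blocks => /(_ ab ab')[].
  have := mi (inr a) (inr a') (inl b).
  by rewrite !in_triangular_blocks => /(_ ab ab')[].
have [_ [_ /one_to_oneP[mf mi] _]] := mok; apply/one_to_oneP.
split=> [a b b'|a a' b] ab ab'.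
  have := mf (inr a) (inl b) (inl b').
  by rewrite !in_triangular_blocks => /(_ ab ab')[].
have := mi (inr a) (inr a') (inl b).
by rewrite !in_triangular_blocks => /(_ ab ab')[].
Qed.

(** Relations that are not matches contribute zero vectors. *)
Lemma sum_matches (A B : rule_diagram) :
  \sum_(m : matches A B) << class_of (composite m) >> = diagram_product A B.
Proof.
rewrite /diagram_product (bigID (fun m => is_match m)) /= [X in _ + X]big1 ?addr0.
  rewrite (big_sub (fun m : match_rel A B => is_match m)).
  by apply: eq_bigr => m _; rewrite -diagram_vectorE.
by move=> m; rewrite is_matchE => /asboolPn/diagram_vector0.
Qed.

Lemma diagram_product_iso (A A' B B' : prediagram) :
  diagram_iso A A' -> diagram_iso B B' -> diagram_product A B = diagram_product A' B'.
Proof.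
move=> [iA [oA [rvA reA mvA meA]]] [iB [oB [rvB reB mvB meB]]].
have [iA' [ivAK ieAK]] := graph_iso_sym iA.
have [oB' [ovBK oeBK]] := graph_iso_sym oB.
pose f (m : match_rel A B) : match_rel A' B' :=
  (rimage (iso_v oB) (iso_v iA) m.1, rimage (iso_e oB) (iso_e iA) m.2).
pose g (m : match_rel A' B') : match_rel A B :=
  (rimage (iso_v oB') (iso_v iA') m.1, rimage (iso_e oB') (iso_e iA') m.2).
have fB : bijective f.
  exists g => [[m1 m2]|[m1 m2]]; first by rewrite /g /f /= !rimageK.
  by rewrite /g /f /= !rimageK //; apply/bij_can_sym => //;
    (exact: iso_v_bij || exact: iso_e_bij).
rewrite /diagram_product [RHS](reindex f) /=; last exact: onW_bij.
by apply: eq_bigr => m _; apply: diagram_vector_iso; exact: (@compose_iso A A' B B' iA oA iB oB m).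
Qed.

(** With its right-hand counterpart, this shows that invalid intermediate composites contribute
    nothing to a triple product. *)
Lemma diagram_product_notl (A B : prediagram) :
  ~ is_rule_diagram A -> diagram_product A B = 0.
Proof.
by move=> notA; apply: big1 => m _; apply: diagram_vector0 => /left_factor_rule_diagram.
Qed.

Lemma diagram_product_notr (A B : prediagram) :
  ~ is_rule_diagram B -> diagram_product A B = 0.
Proof.
by move=> notB; apply: big1 => m _; apply: diagram_vector0 => /right_factor_rule_diagram.
Qed.

(** Each side is a sum over all triples of blocks; [right_matches], applied to vertices and edges
    separately, matches the terms up to isomorphism. *)
Lemma diagram_product_assoc (A B C : prediagram) :
  \sum_(m : match_rel A B) diagram_product (compose m) C =
  \sum_(m : match_rel B C) diagram_product A (compose m).
Proof.
pose L : finType := ({set vert (out C) * (vert (inp A) + vert (inp B))} *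
                     {set edge (out C) * (edge (inp A) + edge (inp B))})%type.
pose R : finType := ({set (vert (out B) + vert (out C)) * vert (inp A)} *
                     {set (edge (out B) + edge (out C)) * edge (inp A)})%type.
pose f (p : match_rel A B * L) : match_rel B C * R :=
  let v := right_matches (p.1.1, p.2.1) in
  let e := right_matches (p.1.2, p.2.2) in ((v.1, e.1), (v.2, e.2)).
pose g (p : match_rel B C * R) : match_rel A B * L :=
  let v := left_matches (p.1.1, p.2.1) in
  let e := left_matches (p.1.2, p.2.2) in ((v.1, e.1), (v.2, e.2)).
have fB : bijective f.
  exists g => -[[v e] [v' e']]; rewrite /f /g -!surjective_pairing.
    by rewrite !right_matchesK.
  by rewrite !left_matchesK.
transitivity (\sum_(p : match_rel A B * L)
    diagram_vector (@compose (compose p.1) C p.2)).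
  exact: pair_bigA (fun (m : match_rel A B) (m' : L) =>
    diagram_vector (@compose (compose m) C m')).
transitivity (\sum_(p : match_rel B C * R)
    diagram_vector (@compose A (compose p.1) p.2)); last first.
  exact/esym/(pair_bigA _ (fun (m : match_rel B C) (m' : R) =>
    diagram_vector (@compose A (compose m) m'))).
rewrite [RHS](reindex f) /=; last exact: onW_bij.
apply: eq_bigr => p _; apply: diagram_vector_iso.
exact: compose_assoc_iso.
Qed.

(** * Bilinearity, associativity and unit laws *)

Section Multiplication.
Variable rep : diagram_class -> rule_diagram.
Hypothesis repK : forall a, class_of (rep a) = a.

Lemma rep_iso (D : rule_diagram) : diagram_iso (rep (class_of D)) D.
Proof.
have /eqP : class_of (rep (class_of D)) = class_of D by rewrite repK.
by rewrite eqmodE => /asboolP.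
Qed.

Lemma mul_basisE a b : mul_basis K rep a b = diagram_product (rep a) (rep b).
Proof. exact: sum_matches. Qed.

Lemma diagram_mulE (x y : algebra) :
  diagram_mul rep x y =
  linear_extension (fun a => linear_extension (mul_basis K rep a) y) x.
Proof.
apply: eq_bigr => a _; rewrite scaler_sumr; apply: eq_bigr => b _.
by rewrite scalerA.
Qed.

Lemma diagram_mul_linearl (y : algebra) : linear ((diagram_mul rep)^~ y).
Proof. by move=> c x x'; rewrite /= !diagram_mulE linear_extension_linear. Qed.

Lemma diagram_mul_linearr (x : algebra) : linear (diagram_mul rep x).
Proof.
move=> c y y'; rewrite !diagram_mulE scaler_sumr -big_split.
apply: eq_bigr => a _; rewrite linear_extension_linear scalerDr !scalerA.
by rewrite mulrC.
Qed.

Lemma diagram_mulUU a b :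
  diagram_mul rep << a >> << b >> = diagram_product (rep a) (rep b).
Proof. by rewrite diagram_mulE !linear_extensionU mul_basisE. Qed.

(** Removes the chosen representative of [D]: for valid [D] by isomorphism invariance, for invalid
    [D] because both sides vanish. *)
Lemma diagram_mul_vectorl (D : prediagram) b :
  diagram_mul rep (diagram_vector D) << b >> = diagram_product D (rep b).
Proof.
have [Dok|Dnot] := pselect (is_rule_diagram D).
  rewrite (diagram_vectorE (RuleDiagram (asboolT Dok))) diagram_mulUU.
  by apply: diagram_product_iso; [exact: rep_iso|exact: diagram_iso_refl].
rewrite diagram_vector0 // diagram_product_notl //.
by rewrite diagram_mulE /linear_extension msupp0 big_seq_fset0.
Qed.

Lemma diagram_mul_vectorr (D : prediagram) a :
  diagram_mul rep << a >> (diagram_vector D) = diagram_product (rep a) D.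
Proof.
have [Dok|Dnot] := pselect (is_rule_diagram D).
  rewrite (diagram_vectorE (RuleDiagram (asboolT Dok))) diagram_mulUU.
  by apply: diagram_product_iso; [exact: diagram_iso_refl|exact: rep_iso].
rewrite diagram_vector0 // diagram_product_notr //.
by rewrite diagram_mulE linear_extensionU /linear_extension msupp0 big_seq_fset0.
Qed.

Lemma diagram_mulA : associative (@diagram_mul K rep).
Proof.
move=> x y z; move: x; apply: eq_linear_basis => [||a].
- exact: diagram_mul_linearl.
- by move=> c x x'; rewrite !diagram_mul_linearl.
move: y; apply: eq_linear_basis => [||b].
- by move=> c y y'; rewrite diagram_mul_linearl diagram_mul_linearr.
- by move=> c y y'; rewrite diagram_mul_linearr diagram_mul_linearl.
move: z; apply: eq_linear_basis => [||c].
- by move=> c z z'; rewrite !diagram_mul_linearr.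
- by move=> c z z'; rewrite !diagram_mul_linearr.
(* On basis vectors the inner product is a sum of composites, over which the outer product
   distributes. *)
rewrite !diagram_mulUU /diagram_product.
rewrite (linear_fun_sum _ _ (diagram_mul_linearr << a >>)).
rewrite (linear_fun_sum _ _ (diagram_mul_linearl << c >>)).
under eq_bigr do rewrite diagram_mul_vectorr.
under [RHS]eq_bigr do rewrite diagram_mul_vectorl.
exact/esym/diagram_product_assoc.
Qed.

Lemma diagram_mul1l : left_id (diagram_unit K) (diagram_mul rep).
Proof.
apply: eq_linear_basis => [||a]; first exact: diagram_mul_linearr.
  by [].
rewrite /diagram_unit -diagram_vectorE diagram_mul_vectorl -[in RHS](repK a).
(* The empty diagram has no inputs, so the only relation into it is empty. *)
have uniq_m (m : match_rel empty_prediagram (rep a)) : m = (set0, set0).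
  by case: m => mv me; congr pair; apply/setP=> -[? []].
rewrite /diagram_product (bigD1 (set0, set0)) //= big1 ?addr0 => [|m].
  rewrite -diagram_vectorE; apply/esym/diagram_vector_iso.
  exact: compose_empty_l_iso.
by rewrite [m]uniq_m eqxx.
Qed.

Lemma diagram_mul1r : right_id (diagram_unit K) (diagram_mul rep).
Proof.
apply: eq_linear_basis => [||a]; first exact: diagram_mul_linearl.
  by [].
rewrite /diagram_unit -diagram_vectorE diagram_mul_vectorr -[in RHS](repK a).
(* The empty diagram has no outputs to be matched. *)
have uniq_m (m : match_rel (rep a) empty_prediagram) : m = (set0, set0).
  by case: m => mv me; congr pair; apply/setP=> -[[]].
rewrite /diagram_product (bigD1 (set0, set0)) //= big1 ?addr0 => [|m].
  rewrite -diagram_vectorE; apply/esym/diagram_vector_iso.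
  exact: compose_empty_r_iso.
by rewrite [m]uniq_m eqxx.
Qed.

End Multiplication.
End DiagramAlgebra.

Theorem theorem2p1 (K : fieldType)
    (rep : diagram_class -> rule_diagram)
    (repK : forall a : diagram_class, class_of (rep a) = a) :
  [/\ (forall x : rule_diagram_algebra K, linear (diagram_mul rep x)),
      (forall y : rule_diagram_algebra K, linear ((diagram_mul rep)^~ y)),
      associative (@diagram_mul K rep),
      left_id (diagram_unit K) (diagram_mul rep)
    & right_id (diagram_unit K) (diagram_mul rep)].
Proof.
split.
- exact: diagram_mul_linearr.
- exact: diagram_mul_linearl.
- exact: diagram_mulA.
- exact: diagram_mul1l.
- exact: diagram_mul1r.
Qed.
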